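(* For every polynomial $h(x)\in\mathbb{C}_p[x]$, $$\int_{\mathbb{Z}_p}w^ah(x+a)\,\mathrm{d}\mu_{-1}(a)=\biggl(\int_{\mathbb{Z}_p}w^ae^{at}\,\mathrm{d}\mu_{-1}(a)\biggr)h(x)=\frac{2}{we^{t}+1}h(x).$$ Equivalently, for every $n\ge 0$, $$E_{n,w}(x)=\biggl(\int_{\mathbb{Z}_p}w^ae^{at}\,\mathrm{d}\mu_{-1}(a)\biggr)x^n=\frac{2}{we^{t}+1}x^n.$$ Here the power series in $t$ act on polynomials in $x$ as differential operators.
   Context: Let $p$ be a fixed odd prime, $\mathbb{C}_p$ the completion of an algebraic closure of $\mathbb{Q}_p$ with absolute value normalized by $|p|_p=p^{-1}$, and let $w\in\mathbb{C}_p$ satisfy $|1-w|_p<1$. For a uniformly differentiable function $F:\mathbb{Z}_p\to\mathbb{C}_p$, the fermionic $p$-adic integral is $\int_{\mathbb{Z}_p}F(a)\,\mathrm{d}\mu_{-1}(a)=\lim_{N\to\infty}\sum_{a=0}^{p^N-1}F(a)(-1)^a$; when the integrand is a polynomial in $x$ whose coefficients depend on $a$, the integral is taken coefficientwise. The expression $\int_{\mathbb{Z}_p}w^ae^{at}\,\mathrm{d}\mu_{-1}(a)$ denotes the formal power series $\sum_{n\ge0}\bigl[\int_{\mathbb{Z}_p}w^aa^n\,\mathrm{d}\mu_{-1}(a)\bigr]\frac{t^n}{n!}$. The weighted Euler polynomials $E_{n,w}(x)$ ($n\ge 0$) are defined by $\frac{2}{we^t+1}e^{xt}=\sum_{n=0}^\infty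 E_{n,w}(x)\frac{t^n}{n!}$ (as formal power series). A formal power series $f(t)=\sum_{k\ge 0}a_k\frac{t^k}{k!}$ with coefficients in $\mathbb{C}_p$ acts as a linear operator on $\mathbb{C}_p[x]$ by letting $t^k$ act as $\frac{\mathrm{d}^k}{\mathrm{d}x^k}$, i.e. $f(t)h(x)=\sum_{k\ge0}\frac{a_k}{k!}h^{(k)}(x)$ (a finite sum). *)

(* Defs.v *)
From HB Require Import structures.
From mathcomp Require Import all_boot all_order all_algebra.
From mathcomp Require Import all_classical all_reals all_analysis.
Set Implicit Arguments.
Unset Strict Implicit.
Unset Printing Implicit Defensive.
Import Order.TTheory GRing.Theory Num.Theory.
Import numFieldNormedType.Exports.
Local Open Scope classical_set_scope.
Local Open Scope ring_scope.

(* An absolute value takes its values in the real numbers [R], so it is kept as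
   a bare function [K -> R]: the library's norms on a field are valued in the
   field itself. *)
Record nonarch_absval (R : realType) (K : fieldType) (abs : K -> R) : Prop := {
  absval_ge0 : forall x, 0 <= abs x;
  absval_eq0 : forall x, abs x = 0 <-> x = 0;
  absvalM : forall x y, abs (x * y) = abs x * abs y;
  absvalD_max : forall x y, abs (x + y) <= Num.max (abs x) (abs y)
}.

Definition abs_cvg (R : realType) (K : fieldType) (abs : K -> R)
    (u : nat -> K) (l : K) : Prop :=
  abs (u n - l) @[n --> \oo] --> (0 : R).

Definition abs_cauchy (R : realType) (K : fieldType) (abs : K -> R)
    (u : nat -> K) : Prop :=
  forall e : R, 0 < e ->
    exists N : nat, forall m n, (N <= m)%N -> (N <= n)%N -> abs (u m - u n) < e.

(* The closure of the prime field.  When [K] is complete of characteristic 0 and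
   [abs] is a nonarchimedean absolute value with |p| = 1/p, this is the
   completion of the rationals for the p-adic absolute value, i.e. Q_p. *)
Definition Qp (R : realType) (K : fieldType) (abs : K -> R) : set K :=
  [set x | exists u : nat -> rat, abs_cvg abs (fun n => ratr (u n)) x].

Definition Zp (R : realType) (K : fieldType) (abs : K -> R) : set K :=
  [set x | Qp abs x /\ abs x <= 1].

Definition Qp_algebraic (R : realType) (K : fieldType) (abs : K -> R) : set K :=
  [set x | exists q : {poly K},
     [/\ q != 0, (forall i : nat, Qp abs q`_i) & root q x]].

(* [(K, abs)] is a completion of an algebraic closure of Q_p, with |p| = 1/p.
   This determines [(K, abs)] up to isometric isomorphism. *)
Record is_Cp (R : realType) (p : nat) (K : fieldType) (abs : K -> R) : Prop := {
  Cp_absval : nonarch_absval abs;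
  Cp_abs_p : abs p%:R = (p%:R)^-1;
  Cp_complete : forall u : nat -> K,
    abs_cauchy abs u -> exists l, abs_cvg abs u l;
  Cp_alg_closure : forall q : {poly K},
    (forall i : nat, Qp_algebraic abs q`_i) -> (1 < size q)%N ->
    exists2 x, Qp_algebraic abs x & root q x;
  Cp_dense : forall x : K, exists2 u : nat -> K,
    (forall n, Qp_algebraic abs (u n)) & abs_cvg abs u x
}.

(* Functions on Z_p are represented by functions on [K]; their values outside
   [Zp abs] are never used. *)

Definition unif_differentiable (R : realType) (K : fieldType) (abs : K -> R)
    (F : K -> K) : Prop :=
  exists F' : K -> K, forall e : R, 0 < e ->
    exists2 d : R, 0 < d & forall x y, Zp abs x -> Zp abs y -> x != y ->
      abs (x - y) < d -> abs ((F x - F y) / (x - y) - F' x) < e.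

Definition is_fermionic_int (R : realType) (p : nat) (K : fieldType)
    (abs : K -> R) (F : K -> K) (l : K) : Prop :=
  unif_differentiable abs F /\
  abs_cvg abs (fun N : nat => \sum_(0 <= a < p ^ N) F a%:R * (-1) ^+ a) l.

Definition fermionic_integrable (R : realType) (p : nat) (K : fieldType)
    (abs : K -> R) (F : K -> K) : Prop :=
  exists l, is_fermionic_int p abs F l.

Definition fermionic_int (R : realType) (p : nat) (K : fieldType)
    (abs : K -> R) (F : K -> K) : K :=
  xget 0 [set l | is_fermionic_int p abs F l].

Definition is_fermionic_int_poly (R : realType) (p : nat) (K : fieldType)
    (abs : K -> R) (G : K -> {poly K}) (P : {poly K}) : Prop :=
  forall i : nat, is_fermionic_int p abs (fun a => (G a)`_i) P`_i.

(* w^a for a in Z_p: the limit of w^m as the natural number m tends to a, i.e.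
   the continuous extension of m |-> w^m, which exists when |1 - w| < 1. *)
Definition is_padic_pow (R : realType) (K : fieldType) (abs : K -> R)
    (w a l : K) : Prop :=
  forall e : R, 0 < e -> exists2 d : R, 0 < d &
    forall m : nat, abs (m%:R - a) < d -> abs (w ^+ m - l) < e.

Definition padic_pow (R : realType) (K : fieldType) (abs : K -> R)
    (w a : K) : K :=
  xget 0 [set l | is_padic_pow abs w a l].

(* [f n] is the coefficient of t^n itself, so the series sum_n a_n t^n/n! is
   [fun n => a n / n`!%:R]. *)
Definition fps (A : Type) : Type := nat -> A.

Definition fps_const (A : pzRingType) (c : A) : fps A :=
  fun n => if n == 0%N then c else 0.

Definition fps_add (A : pzRingType) (f g : fps A) : fps A :=
  fun n => f n + g n.

Definition fps_scale (A : pzRingType) (c : A) (f : fps A) : fps A :=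
  fun n => c * f n.

Definition fps_mul (A : pzRingType) (f g : fps A) : fps A :=
  fun n => \sum_(i < n.+1) f i * g (n - i)%N.

(* The multiplicative inverse, and 0 when [f] is not invertible. *)
Definition fps_inv (K : fieldType) (f : fps K) : fps K :=
  xget (fun=> 0) [set g : nat -> K | fps_mul f g = fps_const 1].

Definition fps_exp (K : fieldType) : fps K := fun n => (n`!%:R)^-1.

(* e^{xt}, with coefficients in K[x] *)
Definition fps_expX (K : fieldType) : fps {poly K} :=
  fun n => (n`!%:R)^-1 *: 'X^n.

Definition euler_series (K : fieldType) (w : K) : fps K :=
  fps_scale 2 (fps_inv (fps_add (fps_scale w (fps_exp K)) (fps_const 1))).

(* E_{n,w}(x): n! times the coefficient of t^n in (2 / (w e^t + 1)) e^{xt} *)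
Definition weighted_euler (K : fieldType) (w : K) (n : nat) : {poly K} :=
  n`!%:R *: fps_mul (fun k => (euler_series w k)%:P) (fps_expX K) n.

(* The integral of w^a e^{at} *)
Definition fermionic_int_exp (R : realType) (p : nat) (K : fieldType)
    (abs : K -> R) (w : K) : fps K :=
  fun n => fermionic_int p abs (fun a => padic_pow abs w a * a ^+ n) / n`!%:R.

(* f(t) h(x), where t^k acts as the k-th derivative; the derivatives of order at
   least [size h] vanish. *)
Definition fps_act (K : fieldType) (f : fps K) (h : {poly K}) : {poly K} :=
  \sum_(k < size h) f k *: h^`(k).

(* Main.v *)
(** The numbers I_n = int w^a a^n are identified with n! times the coefficients
    of 2 / (w e^t + 1) through a recurrence: the partial sums
    S_N(n) = sum_(a < p^N) w^a a^n (-1)^a satisfy, by telescoping,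
    w sum_i C(n, i) S_N(i) + S_N(n) = 0^n + w^(p^N) p^(N n), whose right-hand
    side tends to 2 * 0^n. Since w + 1 <> 0 (p is odd and |1 - w| < 1), strong
    induction on n shows at once that S_N(n) converges and what its limit is.
    The other analytic input is that a |-> w^a is uniformly differentiable on
    Z_p, with derivative l w^a where l = lim (w^(p^k) - 1) / p^k. Taylor's
    formula h(x + a) = sum_k a^k / k! h^(k)(x) then reduces every polynomial h
    to the moments I_n. *)
Require Import Defs.
From HB Require Import structures.
From mathcomp Require Import all_boot all_order all_algebra.
From mathcomp Require Import all_classical all_reals all_analysis.
From mathcomp Require Import ring lra zify.
Import Order.TTheory GRing.Theory Num.Theory.
Import numFieldNormedType.Exports.
Local Open Scope ring_scope.

(** * Nonarchimedean absolute values and limits *)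

Section Nonarchimedean.
Context {R : realType} {K : fieldType} {abs : K -> R}.
Hypothesis absA : nonarch_absval abs.

Lemma abs_ge0 x : 0 <= abs x. Proof. exact: absval_ge0 absA x. Qed.

Lemma abs0 : abs 0 = 0. Proof. exact/(absval_eq0 absA). Qed.

Lemma absM x y : abs (x * y) = abs x * abs y.
Proof. exact: absvalM absA x y. Qed.

Lemma abs_eq0 x : (abs x == 0) = (x == 0).
Proof. by apply/eqP/eqP => /(absval_eq0 absA). Qed.

Lemma abs_gt0 x : (0 < abs x) = (x != 0).
Proof. by rewrite lt_def abs_ge0 andbT abs_eq0. Qed.

Lemma abs1 : abs 1 = 1.
Proof.
have n0 : abs 1 != 0 by rewrite abs_eq0 oner_neq0.
by apply: (mulfI n0); rewrite mulr1 -absM mulr1.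
Qed.

Lemma absN1 : abs (-1) = 1.
Proof.
have : abs (-1) ^+ 2 = 1 by rewrite expr2 -absM mulrNN mulr1 abs1.
move/eqP; rewrite sqrf_eq1 => /orP[/eqP //|/eqP h].
by have := abs_ge0 (-1); rewrite h; lra.
Qed.

Lemma absN x : abs (- x) = abs x.
Proof. by rewrite -mulN1r absM absN1 mul1r. Qed.

Lemma abs_distC x y : abs (x - y) = abs (y - x).
Proof. by rewrite -absN opprB. Qed.

Lemma absV x : abs x^-1 = (abs x)^-1.
Proof.
have [->|x0] := eqVneq x 0; first by rewrite invr0 abs0 invr0.
have n0 : abs x != 0 by rewrite abs_eq0.
by apply: (mulfI n0); rewrite -absM !divff // abs1.
Qed.

Lemma absX x n : abs (x ^+ n) = abs x ^+ n.
Proof. by elim: n => [|n IH]; rewrite ?expr0 ?abs1 // !exprS absM IH. Qed.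

Lemma absD_le c x y : abs x <= c -> abs y <= c -> abs (x + y) <= c.
Proof.
by move=> xc yc; rewrite (le_trans (absvalD_max absA x y))// ge_max xc.
Qed.

Lemma absB_le c x y : abs x <= c -> abs y <= c -> abs (x - y) <= c.
Proof. by move=> xc yc; rewrite absD_le ?absN. Qed.

Lemma absD_lt c x y : abs x < c -> abs y < c -> abs (x + y) < c.
Proof.
by move=> xc yc; rewrite (le_lt_trans (absvalD_max absA x y))// gt_max xc.
Qed.

Lemma absB_lt c x y : abs x < c -> abs y < c -> abs (x - y) < c.
Proof. by move=> xc yc; rewrite absD_lt ?absN. Qed.

Lemma abs_sum_le c (I : Type) (r : seq I) (P : pred I) (F : I -> K) :
  0 <= c -> (forall i, P i -> abs (F i) <= c) -> abs (\sum_(i <- r | P i) F i) <= c.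
Proof.
move=> c0 Fc; elim/big_ind : _ => //; first by rewrite abs0.
by move=> x y; exact: absD_le.
Qed.

Lemma abs_nat_le1 n : abs n%:R <= 1.
Proof.
elim: n => [|n IH]; first by rewrite abs0.
by rewrite -natr1 absD_le ?abs1.
Qed.

Lemma abs_int_le1 (z : int) : abs z%:~R <= 1.
Proof. by case: z => n; rewrite ?NegzE ?mulrNz ?absN -?pmulrn abs_nat_le1. Qed.

Lemma abs_cvgP (u : nat -> K) l : abs_cvg abs u l <->
  forall e : R, 0 < e -> exists N, forall n, (N <= n)%N -> abs (u n - l) < e.
Proof.
split=> [/cvgr0Pnorm_lt h e /h [N _ hN]|h].
  by exists N => n /hN /=; rewrite ger0_norm ?abs_ge0.
apply/cvgr0Pnorm_lt => e /h[N hN].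
by exists N => // n /hN /=; rewrite ger0_norm ?abs_ge0.
Qed.

Lemma abs_eq_small x : (forall e, 0 < e -> abs x < e) -> x = 0.
Proof.
move=> h; apply/eqP; rewrite -abs_eq0 eq_le abs_ge0 andbT leNgt.
by apply/negP => /h; rewrite ltxx.
Qed.

Lemma abs_cvg_unique (u : nat -> K) l m : abs_cvg abs u l -> abs_cvg abs u m -> l = m.
Proof.
move=> /abs_cvgP ul /abs_cvgP um; apply/subr0_eq/abs_eq_small => e e0.
have [N hN] := ul e e0; have [M hM] := um e e0.
have -> : l - m = (u (maxn N M) - m) - (u (maxn N M) - l) by ring.
by rewrite absB_lt// ?hN ?hM ?leq_maxl ?leq_maxr.
Qed.

Lemma abs_cvg_cst c : abs_cvg abs (fun=> c) c.
Proof. by apply/abs_cvgP => e e0; exists 0%N => n _; rewrite subrr abs0. Qed.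

Lemma abs_cvgD (u v : nat -> K) l m : abs_cvg abs u l -> abs_cvg abs v m ->
  abs_cvg abs (fun n => u n + v n) (l + m).
Proof.
move=> /abs_cvgP ul /abs_cvgP vm; apply/abs_cvgP => e e0.
have [N hN] := ul e e0; have [M hM] := vm e e0.
exists (maxn N M) => n; rewrite geq_max => /andP[Nn Mn].
by rewrite opprD addrACA absD_lt ?hN ?hM.
Qed.

Lemma abs_cvgZ (u : nat -> K) l c : abs_cvg abs u l ->
  abs_cvg abs (fun n => c * u n) (c * l).
Proof.
have [->|c0] := eqVneq c 0.
  move=> _; rewrite mul0r; under [X in abs_cvg _ X]eq_fun do rewrite mul0r.
  exact: abs_cvg_cst.
move=> /abs_cvgP ul; apply/abs_cvgP => e e0.
have c0' : 0 < abs c by rewrite abs_gt0.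
have [|N hN] := ul (e / abs c); first by rewrite divr_gt0.
by exists N => n /hN; rewrite ltr_pdivlMr // -mulrBr absM mulrC.
Qed.

Lemma abs_cvg_sum (n : nat) (u : nat -> nat -> K) (l : nat -> K) :
  (forall i, (i < n)%N -> abs_cvg abs (u i) (l i)) ->
  abs_cvg abs (fun N => \sum_(i < n) u i N) (\sum_(i < n) l i).
Proof.
elim: n => [|n IH] h.
  rewrite big_ord0; under [X in abs_cvg _ X]eq_fun do rewrite big_ord0.
  exact: abs_cvg_cst.
rewrite big_ord_recr; under [X in abs_cvg _ X]eq_fun do rewrite big_ord_recr.
by apply: abs_cvgD; [apply: IH => i ni; apply/h/ltnW|exact: h].
Qed.

Lemma expr_lt_eventually (c e : R) : 0 <= c < 1 -> 0 < e ->
  exists N, forall n, (N <= n)%N -> c ^+ n < e.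
Proof.
move=> /andP[c0 c1] e0.
have /cvgr0Pnorm_lt /(_ e e0) [N _ hN] : (c ^+ x @[x --> \oo] --> (0 : R))%classic.
  by apply: cvg_expr; rewrite ger0_norm.
by exists N => n /hN /=; rewrite ger0_norm ?exprn_ge0.
Qed.

(** By the strong triangle inequality, a sum of consecutive steps is no larger than the largest of
    them. *)
Lemma ultrametric_cauchy (v : nat -> K) :
  (forall e : R, 0 < e -> exists N, forall k, (N <= k)%N -> abs (v k.+1 - v k) < e) ->
  abs_cauchy abs v.
Proof.
move=> h e e0; have [N hN] := h e e0; exists N.
have vN k : (N <= k)%N -> abs (v k - v N) < e.
  elim: k => [|k IH]; first by rewrite leqn0 => /eqP <-; rewrite subrr abs0.
  rewrite leq_eqVlt => /orP[/eqP->|]; first by rewrite subrr abs0.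
  rewrite ltnS => Nk; rewrite -(subrK (v k) (v k.+1)) -addrA absD_lt ?IH//.
  exact: hN.
move=> m n /vN mN /vN nN.
have -> : v m - v n = (v m - v N) - (v n - v N) by ring.
exact: absB_lt.
Qed.

End Nonarchimedean.

(** * Absolute values of integers, and density of the naturals in Z_p *)

Section PadicIntegers.
Context {R : realType} {p : nat} {K : fieldType} {abs : K -> R}.
Hypothesis p_prime : prime p.
Hypothesis absA : nonarch_absval abs.
Hypothesis abs_p : abs p%:R = p%:R^-1.

Let p_gt0 : (0 < p%:R :> R). Proof. by rewrite ltr0n prime_gt0. Qed.

Lemma invp_itv : 0 <= (p%:R^-1 : R) < 1.
Proof. by rewrite invr_ge0 ler0n invf_lt1// ltr1n prime_gt1. Qed.

Lemma abs_pX k : abs (p ^ k)%:R = p%:R^-1 ^+ k.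
Proof. by rewrite natrX (absX absA) abs_p. Qed.

(** Bezout writes 1 as [u m - v p]; if |m| < 1, both terms have absolute value below 1,
    contradicting |1| = 1. *)
Lemma abs_nat_coprime m : coprime p m -> abs m%:R = 1.
Proof.
move=> cpm; apply/eqP; rewrite eq_le abs_nat_le1//= leNgt; apply/negP => m1.
have m_gt0 : (0 < m)%N.
  case: m cpm {m1} => //; rewrite /coprime gcdn0.
  by move/eqP=> p1; move: p_prime; rewrite p1.
have [u v uv _] := egcdnP p m_gt0.
have : abs 1 < 1.
  have -> : 1 = u%:R * m%:R - v%:R * p%:R :> K.
    rewrite -!natrM uv.
    by move: cpm; rewrite coprime_sym => /eqP ->; rewrite natrD; ring.
  apply: (absB_lt absA); rewrite (absM absA).
    by rewrite (le_lt_trans _ m1)// ler_piMl ?abs_ge0// abs_nat_le1.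
  rewrite abs_p; have /andP[p0 p1] := invp_itv.
  by rewrite (le_lt_trans _ p1)// ler_piMl // abs_nat_le1.
by rewrite (abs1 absA) ltxx.
Qed.

Lemma natr_neq0 n : (0 < n)%N -> n%:R != 0 :> K.
Proof.
move=> n0; have [m cpm ->] := pfactor_coprime p_prime n0.
rewrite natrM mulf_neq0 // -(abs_eq0 absA).
  by rewrite abs_nat_coprime // oner_eq0.
by rewrite abs_pX expf_neq0// invr_eq0 gt_eqF.
Qed.

Lemma abs_int_coprime (z : int) : coprime p `|z|%N -> abs z%:~R = 1.
Proof.
by case: z => n; rewrite ?NegzE ?mulrNz ?(absN absA) -?pmulrn => /abs_nat_coprime.
Qed.

Lemma abs_nat_lt1 n : (abs n%:R < 1) = (p %| n)%N.
Proof.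
have [pn|] := boolP (p %| n)%N.
  move: pn => /dvdnP[m ->]; rewrite natrM (absM absA) abs_p.
  have /andP[p0 p1] := invp_itv.
  by rewrite (le_lt_trans _ p1)// ler_piMl // abs_nat_le1.
by rewrite -prime_coprime// => /abs_nat_coprime ->; rewrite ltxx.
Qed.

(* A rational of absolute value at most 1 has a denominator prime to p, which
   is therefore invertible modulo every power of p. *)
Lemma Zp_nat_dense x : Defs.Zp abs x ->
  forall e, 0 < e -> exists m : nat, abs (m%:R - x) < e.
Proof.
move=> [[u /(abs_cvgP absA) ux] x1] e e0.
(* Closeness within 1 forces the rational approximation [q] to satisfy |q| <= 1. *)
have [N uN] := ux (Num.min e 1) ltac:(by rewrite lt_min e0 ltr01).
have := uN N (leqnn N); set q := u N; rewrite lt_min => /andP[qe q1].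
have {q1} abs_q : abs (ratr q) <= 1.
  by rewrite -(subrK x (ratr q)) (absD_le absA)// ltW.
pose d := `|denq q|%N; have dE : denq q = d by rewrite absz_denq.
have d_gt0 : (0 < d)%N by rewrite absz_gt0 denq_neq0.
have d0 : d%:R != 0 :> K by exact: natr_neq0.
have qE : ratr q * d%:R = (numq q)%:~R :> K by rewrite /ratr dE -pmulrn divfK.
have cpd : coprime p d.
  (* If p divided [d], the numerator would be prime to p and have absolute value 1, while it equals
     [q d], of absolute value below 1. *)
  rewrite prime_coprime// -abs_nat_lt1; apply/negP => d1.
  have : coprime p `|numq q|.
    have := coprime_num_den q.
    rewrite abs_nat_lt1 in d1.
    by move=> /(coprime_dvdr d1); rewrite coprime_sym.
  move=> /abs_int_coprime; rewrite -qE (absM absA) => h.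
  have : abs (ratr q) * abs d%:R < 1.
    by rewrite (le_lt_trans _ d1)// ler_piMl ?abs_ge0.
  by rewrite h ltxx.
have [k /(_ k (leqnn k)) ke] := expr_lt_eventually _ _ invp_itv e0.
(* [a] inverts [d] modulo p^k; with [r] the residue of the numerator, the natural number [a r] is
   congruent to [q] modulo p^k. *)
have [a b ab _] := @egcdnP d (p ^ k) d_gt0.
have {}ab : (a * d = b * p ^ k + 1)%N.
  by rewrite ab; congr addn; apply/eqP; rewrite -/(coprime _ _) coprime_sym coprimeXl.
pose r := `|(numq q %% (p ^ k)%N)%Z|%N.
have rE : (numq q)%:~R = ((numq q %/ (p ^ k)%N)%Z)%:~R * (p ^ k)%:R + r%:R :> K.
  rewrite {1}(divz_eq (numq q) (p ^ k)%N) rmorphD rmorphM /=; congr (_ + _).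
  rewrite /r [RHS]pmulrn gez0_abs// modz_ge0// eqz_nat.
  by rewrite expn_eq0 negb_and -lt0n prime_gt0.
exists (a * r)%N.
rewrite -(subrK (ratr q) (a * r)%:R) -addrA (absD_lt absA)//.
have -> : (a * r)%:R - ratr q =
  (p ^ k)%:R * ((b * r)%:R - ((numq q %/ (p ^ k)%N)%Z)%:~R) / d%:R :> K.
  apply: (mulIf d0); rewrite divfK// mulrBl qE rE -natrM mulnAC ab.
  by rewrite mulnDl mul1n natrD !natrM; ring.
rewrite !(absM absA) (absV absA) (abs_nat_coprime d)// invr1 mulr1 abs_pX.
rewrite (le_lt_trans _ ke)// ler_piMr ?exprn_ge0 ?invr_ge0 ?ler0n//.
by rewrite (absB_le absA) ?abs_nat_le1 ?abs_int_le1.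
Qed.

End PadicIntegers.

(** * The function w^a on Z_p and its uniform differentiability *)

Section PadicPower.
Context {R : realType} {p : nat} {K : fieldType} {abs : K -> R}.
Hypothesis p_prime : prime p.
Hypothesis absA : nonarch_absval abs.
Hypothesis abs_p : abs p%:R = p%:R^-1.
Hypothesis abs_complete : forall u : nat -> K,
  abs_cauchy abs u -> exists l, abs_cvg abs u l.
Context {w : K}.
Hypothesis w_lt1 : abs (1 - w) < 1.

Let r : R := Num.max (abs (w - 1)) p%:R^-1.

Let r_itv : 0 <= r < 1.
Proof.
rewrite le_max gt_max (abs_ge0 absA)/= (abs_distC absA) w_lt1.
by have /andP[_ ->] := @invp_itv R p p_prime.
Qed.

Lemma abs_w : abs w = 1.
Proof.
have h u : abs (1 - u) < 1 -> abs u <= 1.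
  move=> u1; have -> : u = 1 - (1 - u) by ring.
  by rewrite (absB_le absA) ?(abs1 absA)// ltW.
apply/eqP; rewrite eq_le h//= leNgt; apply/negP => w1.
have : abs (1 - w + w) < 1 by rewrite (absD_lt absA).
by rewrite subrK (abs1 absA) ltxx.
Qed.

Lemma abs_wX n : abs (w ^+ n) = 1.
Proof. by rewrite (absX absA) abs_w expr1n. Qed.

(** The cofactor 1 + u + ... + u^(n-1) of u - 1 has absolute value at most 1. *)
Lemma abs_expr_sub1 (u : K) n : abs u <= 1 -> abs (u ^+ n - 1) <= abs (u - 1).
Proof.
move=> u1; rewrite subrX1 (absM absA) ler_piMr ?(abs_ge0 absA)//.
apply: (abs_sum_le absA) => // i _.
by rewrite (absX absA) exprn_ile1 // (abs_ge0 absA).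
Qed.

Lemma abs_sum_expr_sub (u : K) n : abs u <= 1 ->
  abs (\sum_(i < n) u ^+ i - n%:R) <= abs (u - 1).
Proof.
move=> u1; have -> : n%:R = \sum_(i < n) 1 :> K by rewrite sumr_const card_ord.
rewrite -sumrB; apply: (abs_sum_le absA) => [|i _]; first exact: abs_ge0.
exact: abs_expr_sub1.
Qed.

Let u k := w ^+ (p ^ k).

(** Raising u = w^(p^k) to the power p multiplies u - 1 by 1 + u + ... + u^(p-1). This factor
    differs from p by at most |u - 1| <= |w - 1|, so its absolute value is at most [r]. *)
Lemma abs_expr_pX k : abs (w ^+ (p ^ k) - 1) <= r ^+ k.
Proof.
have /andP[r0 r1] := r_itv.
elim: k => [|k IH].
  by rewrite expn0 expr1 expr0 (abs_distC absA) ltW.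
have u1 : abs (w ^+ (p ^ k)) <= 1 by rewrite abs_wX.
rewrite expnSr exprM subrX1 (absM absA) exprSr.
rewrite ler_pM ?(abs_ge0 absA)//.
rewrite -[X in abs X](subrK p%:R) (absD_le absA)//.
  rewrite (le_trans (abs_sum_expr_sub _ _ u1))//.
  rewrite (le_trans (abs_expr_sub1 _ _ _)) ?abs_w//.
  by rewrite /r le_max lexx.
by rewrite abs_p /r le_max lexx orbT.
Qed.

Lemma abs_expr_sub1_small e : 0 < e -> exists k, forall j,
  (p ^ k %| j)%N -> abs (w ^+ j - 1) < e.
Proof.
move=> e0; have [k /(_ k (leqnn k)) ke] := expr_lt_eventually _ _ r_itv e0.
exists k => _ /dvdnP[m ->]; rewrite mulnC exprM.
rewrite (le_lt_trans _ ke)// (le_trans (abs_expr_sub1 _ _ _)) ?abs_wX//.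
exact: abs_expr_pX.
Qed.

(** For nonzero j, |j| = p^(-v) with v the exponent of p in j. *)
Lemma abs_nat_lt_pX k j : abs j%:R < p%:R^-1 ^+ k -> (p ^ k %| j)%N.
Proof.
case: j => // j; have [m cpm ->] := pfactor_coprime p_prime (ltn0Sn j).
rewrite natrM (absM absA) (abs_nat_coprime p_prime absA abs_p)// mul1r.
rewrite (abs_pX absA abs_p) => h; apply/dvdn_mull/dvdn_exp2l.
rewrite leqNgt; apply/negP => /ltnW sk; move: h; apply/negP; rewrite -leNgt.
by have /andP[p0 /ltW p1] := @invp_itv R p p_prime; rewrite ler_wiXn2l.
Qed.

Lemma abs_expr_sub_small e : 0 < e -> exists2 d, 0 < d &
  forall m n : nat, abs (m%:R - n%:R) < d -> abs (w ^+ m - w ^+ n) < e.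
Proof.
move=> e0; have [k kP] := abs_expr_sub1_small e e0.
exists (p%:R^-1 ^+ k); first by rewrite exprn_gt0// invr_gt0 ltr0n prime_gt0.
move=> m n; wlog nm : m n / (n <= m)%N.
  move=> wl; have [/wl//|/ltnW /wl h] := leqP n m.
  by rewrite !(abs_distC absA m%:R, abs_distC absA (w ^+ m)).
rewrite -natrB// => /abs_nat_lt_pX /kP.
have -> : w ^+ m = w ^+ (m - n) * w ^+ n by rewrite -exprD subnK.
by rewrite -[X in _ * _ - X]mul1r -mulrBl (absM absA) abs_wX mulr1.
Qed.

(** Difference quotients at 0 along the powers of p; their limit is the p-adic logarithm of w. *)
Let L k := (u k - 1) / (p ^ k)%:R.

Let pX0 k : (p ^ k)%:R != 0 :> K.
Proof. by rewrite (natr_neq0 p_prime absA abs_p) ?expn_gt0 ?prime_gt0. Qed.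

Let LS k : L k.+1 - L k = L k * (\sum_(i < p) u k ^+ i - p%:R) / p%:R.
Proof.
have p0 : p%:R != 0 :> K by rewrite (natr_neq0 p_prime absA abs_p) ?prime_gt0.
have := pX0 k; rewrite /L /u expnSr exprM subrX1 natrM => pk0.
by field; rewrite p0 pk0.
Qed.

Let L_diff k : abs (L k.+1 - L k) <= abs (L k) * (p%:R * r ^+ k).
Proof.
rewrite LS; move: (L k) => a; rewrite !(absM absA) (absV absA) abs_p invrK -mulrA.
rewrite ler_wpM2l ?(abs_ge0 absA)// mulrC ler_wpM2l ?ler0n//.
by rewrite (le_trans (abs_sum_expr_sub _ _ _)) ?abs_wX ?abs_expr_pX.
Qed.

Let L_diff_small e : 0 < e ->
  exists N, forall k, (N <= k)%N -> p%:R * r ^+ k < e.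
Proof.
move=> e0; have p0 : (0 : R) < p%:R by rewrite ltr0n prime_gt0.
have [|N hN] := expr_lt_eventually _ (e / p%:R) r_itv; first by rewrite divr_gt0.
by exists N => k /hN; rewrite ltr_pdivlMr// mulrC.
Qed.

(** Once p r^k < 1, each increment is at most |L k|, so |L k| no longer increases. *)
Let L_bounded : exists B, exists N, forall k, (N <= k)%N -> abs (L k) <= B.
Proof.
have [N hN] := L_diff_small 1 ltr01.
exists (abs (L N)), N => k; elim: k => [|k IH]; first by rewrite leqn0 => /eqP ->.
rewrite leq_eqVlt => /orP[/eqP->//|]; rewrite ltnS => Nk.
rewrite -(subrK (L k) (L k.+1)) (absD_le absA) ?IH//.
rewrite (le_trans (L_diff k))// (le_trans _ (IH Nk))// ler_piMr ?(abs_ge0 absA)//.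
exact/ltW/hN.
Qed.

(* With u = w^(p^k) and j = p^k c, p not dividing c, (w^j - 1) / j is
   ((u - 1) / p^k) (1 + u + ... + u^(c-1)) / c, whose last factor tends to 1. *)
Lemma expr_deriv0 : exists l, forall e, 0 < e -> exists2 d, 0 < d &
  forall j : nat, abs j%:R < d -> abs (w ^+ j - 1 - l * j%:R) <= e * abs j%:R.
Proof.
have [B [N0 LB]] := L_bounded.
have B0 : 0 <= B by rewrite (le_trans (abs_ge0 absA _) (LB N0 _)).
(* [B] may be 0, so the tolerances are divided by [B + 1]. *)
have B1 : 0 < B + 1 by rewrite ltr_wpDl.
have [|l /(abs_cvgP absA) Ll] := abs_complete L.
  apply: (ultrametric_cauchy absA) => e e0.
  have [|N hN] := L_diff_small (e / (B + 1)); first by rewrite divr_gt0.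
  exists (maxn N0 N) => k; rewrite geq_max => /andP[/LB kB /hN].
  rewrite ltr_pdivlMr// => ke; rewrite (le_lt_trans (L_diff k))//.
  rewrite (le_lt_trans _ ke)// mulrC ler_wpM2l ?mulr_ge0 ?ler0n ?exprn_ge0//.
    by have /andP[] := r_itv.
  by rewrite (le_trans kB) // lerDl.
exists l => e e0; have [N1 hN1] := Ll e e0.
have [|N2 hN2] := expr_lt_eventually _ (e / (B + 1)) r_itv; first by rewrite divr_gt0.
pose N := maxn N0 (maxn N1 N2).
exists (p%:R^-1 ^+ N); first by rewrite exprn_gt0// invr_gt0 ltr0n prime_gt0.
move=> [|j jN]; first by rewrite expr0 subrr mulr0 subrr (abs0 absA) mulr0.
have [c cpc jE] := pfactor_coprime p_prime (ltn0Sn j).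
set k := logn _ _ in jE.
have : (N <= k)%N by rewrite /k -pfactor_dvdn// abs_nat_lt_pX.
rewrite !geq_max => /and3P[/LB Nk /hN1 N1k /hN2 N2k].
rewrite jE mulnC exprM -/(u k) natrM (absM absA).
rewrite (abs_nat_coprime p_prime absA abs_p c)// mulr1.
(* Two errors: the geometric sum against [c], weighted by the bounded [L k], and [L k] against [l].
   Since |c| = 1, the common factor p^k has the absolute value of j. *)
have -> : u k ^+ c - 1 - l * ((p ^ k)%:R * c%:R) =
   (L k * (\sum_(i < c) u k ^+ i - c%:R) + (L k - l) * c%:R) * (p ^ k)%:R.
  by rewrite subrX1; have := pX0 k; rewrite /L => pk0; field.
rewrite (absM absA) ler_wpM2r ?(abs_ge0 absA)// (absD_le absA)//; last first.
  rewrite (absM absA) (abs_nat_coprime p_prime absA abs_p c)// mulr1; exact: ltW.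
rewrite (absM absA); move: N2k; rewrite ltr_pdivlMr// => /ltW N2k.
rewrite (le_trans _ N2k)// mulrC ler_pM ?(abs_ge0 absA)//.
  by rewrite (le_trans (abs_sum_expr_sub _ _ _)) ?abs_wX ?abs_expr_pX.
by rewrite (le_trans Nk)// lerDl.
Qed.

(** Factoring out the smaller power reduces to the derivative at 0, because powers of w have
    absolute value 1. *)
Lemma expr_unif_deriv : exists l, forall e, 0 < e -> exists2 d, 0 < d &
  forall m n : nat, abs (m%:R - n%:R) < d ->
    abs (w ^+ m - w ^+ n - l * w ^+ m * (m%:R - n%:R)) <= e * abs (m%:R - n%:R).
Proof.
have [l hl] := expr_deriv0; exists l => e e0.
have [d1 d10 h1] := hl e e0.
have l1 : 0 < abs l + 1 by rewrite ltr_wpDl ?(abs_ge0 absA).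
have [|d2 d20 h2] := abs_expr_sub_small (e / (abs l + 1)); first by rewrite divr_gt0.
exists (Num.min d1 d2) => [|m n]; first by rewrite lt_min d10.
rewrite lt_min => /andP[md1 md2].
have [nm|/ltnW mn] := leqP n m.
  have j1 := h1 (m - n)%N; rewrite natrB// in j1.
  (* The derivative is taken at m but [w ^+ n] is factored out; uniform continuity bounds the
     correction. *)
  have -> : w ^+ m - w ^+ n - l * w ^+ m * (m%:R - n%:R) =
      w ^+ n * (w ^+ (m - n) - 1 - l * (m%:R - n%:R)) - 
      l * (w ^+ m - w ^+ n) * (m%:R - n%:R).
    have -> : w ^+ m = w ^+ (m - n) * w ^+ n by rewrite -exprD subnK.
    by move: (w ^+ (m - n)) => v; ring.
  rewrite (absB_le absA)//; first by rewrite (absM absA) abs_wX mul1r j1.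
  rewrite !(absM absA) ler_wpM2r ?(abs_ge0 absA)//.
  have := h2 _ _ md2; rewrite ltr_pdivlMr// => /ltW; apply: le_trans.
  by rewrite mulrC ler_wpM2l ?(abs_ge0 absA)// lerDl.
have j1 := h1 (n - m)%N; rewrite natrB// (abs_distC absA) in j1.
have -> : w ^+ m - w ^+ n - l * w ^+ m * (m%:R - n%:R) =
    - (w ^+ m * (w ^+ (n - m) - 1 - l * (n%:R - m%:R))).
  have -> : w ^+ n = w ^+ (n - m) * w ^+ m by rewrite -exprD subnK.
  by move: (w ^+ (n - m)) => v; ring.
by rewrite (absN absA) (absM absA) abs_wX mul1r j1.
Qed.

(** Along naturals tending to a, the powers of w are Cauchy by uniform continuity, which also makes
    the limit independent of the chosen sequence. *)
Lemma padic_pow_exists a : Defs.Zp abs a -> exists l, is_padic_pow abs w a l.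
Proof.
move=> aZ.
have /choice [m mP] : forall k : nat, exists m : nat, abs (m%:R - a) < p%:R^-1 ^+ k.
  move=> k; apply: (Zp_nat_dense p_prime absA abs_p) => //.
  by rewrite exprn_gt0// invr_gt0 ltr0n prime_gt0.
have m_small d : 0 < d -> exists N, forall k, (N <= k)%N -> abs ((m k)%:R - a) < d.
  move=> d0; have [N hN] := expr_lt_eventually _ _ (@invp_itv R p p_prime) d0.
  by exists N => k /hN; apply: lt_trans.
have [|l /(abs_cvgP absA) ml] := abs_complete (fun k => w ^+ m k).
  move=> e e0; have [d d0 hd] := abs_expr_sub_small e e0.
  have [N hN] := m_small d d0; exists N => i j /hN Ni /hN Nj; apply: hd.
  have -> : (m i)%:R - (m j)%:R = ((m i)%:R - a) - ((m j)%:R - a) by ring.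
  exact: absB_lt.
exists l => e e0; have [d d0 hd] := abs_expr_sub_small e e0.
exists d => // n na; have [N hN] := m_small d d0; have [M hM] := ml e e0.
set k := maxn N M.
rewrite -(subrK (w ^+ m k) (w ^+ n)) -addrA (absD_lt absA) ?hM ?leq_maxr//.
apply: hd; have -> : n%:R - (m k)%:R = (n%:R - a) - ((m k)%:R - a) by ring.
by rewrite (absB_lt absA)// hN ?leq_maxl.
Qed.

Lemma padic_powP a : Defs.Zp abs a -> is_padic_pow abs w a (padic_pow abs w a).
Proof. by move=> /padic_pow_exists; exact: xgetPex. Qed.

Lemma padic_pow_nat (n : nat) : padic_pow abs w n%:R = w ^+ n.
Proof.
have nP : is_padic_pow abs w n%:R (w ^+ n).
  by move=> e /abs_expr_sub_small[d d0 hd]; exists d => // m /hd.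
have : is_padic_pow abs w n%:R (padic_pow abs w n%:R) by exact: xgetI nP.
move=> h; apply/esym/subr0_eq/(abs_eq_small absA) => e /h[d d0 hd].
by apply: hd; rewrite subrr (abs0 absA).
Qed.

Lemma padic_pow_approx a e : Defs.Zp abs a -> 0 < e ->
  exists m : nat, abs (m%:R - a) < e /\ abs (w ^+ m - padic_pow abs w a) < e.
Proof.
move=> aZ e0; have [d d0 hd] := padic_powP a aZ e e0.
have [|m] := Zp_nat_dense p_prime absA abs_p a aZ (Num.min e d).
  by rewrite lt_min e0.
by rewrite lt_min => /andP[me md]; exists m; split=> //; exact: hd.
Qed.

Lemma abs_padic_pow_le1 a : Defs.Zp abs a -> abs (padic_pow abs w a) <= 1.
Proof.
move=> aZ; have [m [_ /ltW h]] := padic_pow_approx a 1 aZ ltr01.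
have -> : padic_pow abs w a = w ^+ m - (w ^+ m - padic_pow abs w a) by ring.
by rewrite (absB_le absA)// abs_wX.
Qed.

(** The estimate passes from naturals to Z_p by density. *)
Lemma padic_pow_unif_deriv : exists l, forall e, 0 < e -> exists2 d, 0 < d &
  forall x y, Defs.Zp abs x -> Defs.Zp abs y -> abs (x - y) < d ->
    abs (padic_pow abs w x - padic_pow abs w y - l * padic_pow abs w x * (x - y))
      <= e * abs (x - y).
Proof.
have [l hl] := expr_unif_deriv; exists l => e e0.
have [d d0 hd] := hl e e0; exists d => // x y xZ yZ xyd.
have [->|xy] := eqVneq x y; first by rewrite !subrr mulr0 subrr (abs0 absA) mulr0.
have l1 : 0 < abs l + 1 by rewrite ltr_wpDl ?(abs_ge0 absA).
have xy0 : 0 < abs (x - y) by rewrite (abs_gt0 absA) subr_eq0.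
have xy1 : abs (x - y) <= 1 by rewrite (absB_le absA) ?(proj2 xZ) ?(proj2 yZ).
(* The first bound keeps |m - n| <= |x - y|; the second keeps an error of size [t] within e |x - y|,
   whether it is multiplied by 1 or by [l]. *)
pose t := Num.min (abs (x - y)) (e * abs (x - y) / (abs l + 1)).
have t0 : 0 < t by rewrite lt_min xy0 divr_gt0 ?mulr_gt0.
have tl s : s <= t -> s * (abs l + 1) <= e * abs (x - y).
  by rewrite le_min => /andP[_]; rewrite ler_pdivlMr.
have [m [mx /ltW wm]] := padic_pow_approx x t xZ t0.
have [n [ny /ltW wn]] := padic_pow_approx y t yZ t0.
set X := padic_pow abs w x in wm *; set Y := padic_pow abs w y in wn *.
have mnxy : abs ((m%:R - n%:R) - (x - y)) <= t.
  have -> : (m%:R - n%:R) - (x - y) = (m%:R - x) - (n%:R - y) :> K by ring.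
  by rewrite (absB_le absA)// ltW.
have mn_le : abs (m%:R - n%:R) <= abs (x - y).
  rewrite -(subrK (x - y) (m%:R - n%:R)) (absD_le absA)//.
  by rewrite (le_trans mnxy)// ge_min lexx.
have le1 s c : abs s <= t -> abs c <= 1 -> abs (s * c) <= e * abs (x - y).
  move=> st c1; rewrite (absM absA).
  have s0 := abs_ge0 absA s; have l0 := abs_ge0 absA l.
  by rewrite (le_trans _ (tl _ st)) // ler_wpM2l// (le_trans c1) // lerDr.
have le2 s c : abs s <= t -> abs c <= 1 -> abs (l * (s * c)) <= e * abs (x - y).
  move=> st c1; rewrite !(absM absA) mulrCA.
  have s0 := abs_ge0 absA s; have l0 := abs_ge0 absA l.
  rewrite (le_trans _ (tl _ st)) // ler_wpM2l//.
  by rewrite (@le_trans _ _ (abs l)) ?ler_piMr// lerDl.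
have -> : X - Y - l * X * (x - y) =
    (w ^+ m - w ^+ n - l * w ^+ m * (m%:R - n%:R))
    - (w ^+ m - X) * 1 + (w ^+ n - Y) * 1
    + l * ((w ^+ m - X) * (x - y))
    + l * (((m%:R - n%:R) - (x - y)) * w ^+ m) by ring.
apply: absD_le => //; last by rewrite le2 ?abs_wX.
apply: absD_le => //; last by rewrite le2.
apply: absD_le => //; last by rewrite le1 ?(abs1 absA).
apply: absB_le => //; last by rewrite le1 ?(abs1 absA).
rewrite (le_trans (hd _ _ (le_lt_trans mn_le xyd)))//.
by rewrite ler_wpM2l// ltW.
Qed.

End PadicPower.

(** * Uniform differentiability and linearity of the fermionic integral *)

Section FermionicIntegral.
Context {R : realType} {p : nat} {K : fieldType} {abs : K -> R}.
Hypothesis absA : nonarch_absval abs.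

(* Uniform differentiability with the difference quotient multiplied out, which
   avoids the case x = y. *)
Definition has_unif_deriv (F F' : K -> K) : Prop :=
  forall e : R, 0 < e -> exists2 d : R, 0 < d &
    forall x y, Defs.Zp abs x -> Defs.Zp abs y -> abs (x - y) < d ->
      abs (F x - F y - F' x * (x - y)) <= e * abs (x - y).

Lemma has_unif_deriv_differentiable F F' :
  has_unif_deriv F F' -> unif_differentiable abs F.
Proof.
(* Halving [e] turns the weak inequality into a strict one. *)
move=> h; exists F' => e e0; have [|d d0 hd] := h (e / 2); first by rewrite divr_gt0.
exists d => // x y xZ yZ xy xyd; rewrite -subr_eq0 in xy.
have xy0 : 0 < abs (x - y) by rewrite (abs_gt0 absA).
rewrite -[F' x](mulfK xy) -mulrBl (absM absA) (absV absA).
rewrite ltr_pdivrMr// (le_lt_trans (hd _ _ xZ yZ xyd))// ltr_pM2r//; lra.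
Qed.

(** In the product rule, the remainder gains the term F'(x) (x - y)^2, which the bound on F' makes
    negligible. *)
Lemma has_unif_deriv_mul_id F F' C :
  (forall x, Defs.Zp abs x -> abs (F' x) <= C) -> has_unif_deriv F F' ->
  has_unif_deriv (fun x => F x * x) (fun x => F' x * x + F x).
Proof.
move=> F'C h e e0; have [d d0 hd] := h e e0.
have C0 : 0 < Num.max C 1 by rewrite lt_max ltr01 orbT.
exists (Num.min d (e / Num.max C 1)) => [|x y xZ yZ].
  by rewrite lt_min d0 divr_gt0.
rewrite lt_min ltr_pdivlMr// => /andP[xyd xye].
have -> : F x * x - F y * y - (F' x * x + F x) * (x - y) =
  (F x - F y - F' x * (x - y)) * y - F' x * (x - y) * (x - y) by ring.
apply: absB_le => //.
  rewrite (absM absA) (le_trans _ (hd _ _ xZ yZ xyd))//.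
  by rewrite ler_piMr ?(abs_ge0 absA) ?(proj2 yZ).
rewrite 2!(absM absA) ler_wpM2r ?(abs_ge0 absA)// (le_trans _ (ltW xye))//.
by rewrite mulrC ler_wpM2l ?(abs_ge0 absA)// le_max F'C.
Qed.

Lemma has_unif_deriv_mulXn F F' C n :
  (forall x, Defs.Zp abs x -> abs (F x) <= 1) ->
  (forall x, Defs.Zp abs x -> abs (F' x) <= C) -> has_unif_deriv F F' ->
  exists G', has_unif_deriv (fun x => F x * x ^+ n) G'.
Proof.
move=> F1 F'C hF.
(* The induction carries bounds on the function and on its derivative, since the product rule
   consumes the latter and the new derivative contains the function. *)
suff [G' [D [_ _ hG]]] : exists G' D,
  [/\ forall x, Defs.Zp abs x -> abs (F x * x ^+ n) <= 1,
      forall x, Defs.Zp abs x -> abs (G' x) <= D &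
      has_unif_deriv (fun x => F x * x ^+ n) G'] by exists G'.
elim: n => [|n [G' [D [G1 G'D hG]]]].
  exists F', C; rewrite [X in has_unif_deriv X](_ : _ = F).
    by split=> // x xZ; rewrite mulr1 F1.
  by apply/funext => x; rewrite mulr1.
have E : (fun x => F x * x ^+ n.+1) = (fun x => F x * x ^+ n * x).
  by apply/funext => x; rewrite exprSr mulrA.
exists (fun x => G' x * x + F x * x ^+ n), (Num.max D 1); split.
- move=> x xZ; rewrite exprSr mulrA (absM absA) mulr_ile1 ?(abs_ge0 absA)//.
    exact: G1.
  exact: (proj2 xZ).
- move=> x xZ; apply: absD_le => //; last by rewrite le_max G1 ?orbT.
  rewrite le_max (absM absA) (le_trans _ (G'D _ xZ))//.
  by rewrite ler_piMr ?(abs_ge0 absA) ?(proj2 xZ).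
- by rewrite E; exact: has_unif_deriv_mul_id G'D hG.
Qed.

Lemma unif_differentiable0 : unif_differentiable abs (fun=> 0).
Proof.
exists (fun=> 0) => e e0; exists 1 => // x y _ _ _ _.
by rewrite !subr0 mul0r (abs0 absA).
Qed.

Lemma unif_differentiableD F G : unif_differentiable abs F ->
  unif_differentiable abs G -> unif_differentiable abs (fun x => F x + G x).
Proof.
move=> [F' hF] [G' hG]; exists (fun x => F' x + G' x) => e e0.
have [d d0 hd] := hF e e0; have [c c0 hc] := hG e e0.
exists (Num.min d c) => [|x y xZ yZ xy]; first by rewrite lt_min d0.
rewrite lt_min => /andP[xyd xyc].
have -> : (F x + G x - (F y + G y)) / (x - y) - (F' x + G' x) =
  ((F x - F y) / (x - y) - F' x) + ((G x - G y) / (x - y) - G' x) by ring.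
by rewrite (absD_lt absA)// (hd, hc).
Qed.

Lemma unif_differentiableZ c F : unif_differentiable abs F ->
  unif_differentiable abs (fun x => c * F x).
Proof.
move=> [F' hF]; exists (fun x => c * F' x) => e e0.
have c1 : 0 < abs c + 1 by rewrite ltr_wpDl ?(abs_ge0 absA).
have [|d d0 hd] := hF (e / (abs c + 1)); first by rewrite divr_gt0.
exists d => // x y xZ yZ xy xyd; have := hd x y xZ yZ xy xyd.
have -> : (c * F x - c * F y) / (x - y) - c * F' x =
  ((F x - F y) / (x - y) - F' x) * c by ring.
rewrite ltr_pdivlMr// => h; rewrite (absM absA) (le_lt_trans _ h)//.
by rewrite ler_wpM2l ?(abs_ge0 absA)// lerDl.
Qed.

Lemma is_fermionic_int_unique F l m :
  is_fermionic_int p abs F l -> is_fermionic_int p abs F m -> l = m.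
Proof. by move=> [_ Fl] [_ Fm]; exact: abs_cvg_unique Fl Fm. Qed.

Lemma fermionic_intE F l : is_fermionic_int p abs F l -> fermionic_int p abs F = l.
Proof.
by move=> Fl; apply: (is_fermionic_int_unique F) => //; exact: xgetI Fl.
Qed.

Lemma is_fermionic_int_lincomb (n : nat) (c l : nat -> K) (F : nat -> K -> K) :
  (forall i, (i < n)%N -> is_fermionic_int p abs (F i) (l i)) ->
  is_fermionic_int p abs (fun a => \sum_(i < n) c i * F i a) (\sum_(i < n) c i * l i).
Proof.
move=> h; split.
  elim: n h => [|n IH] h.
    rewrite [X in unif_differentiable _ X](_ : _ = fun=> 0).
      exact: unif_differentiable0.
    by apply/funext => a; rewrite big_ord0.
  under [X in unif_differentiable _ X]eq_fun do rewrite big_ord_recr.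
  apply: unif_differentiableD; first by apply: IH => i ni; apply/h/ltnW.
  exact/unif_differentiableZ/(proj1 (h n _)).
have -> : (fun N => \sum_(0 <= a < p ^ N) (\sum_(i < n) c i * F i a%:R) * (-1) ^+ a) =
    (fun N => \sum_(i < n) c i * (\sum_(0 <= a < p ^ N) F i a%:R * (-1) ^+ a)).
  apply/funext => N; under eq_bigr do rewrite mulr_suml.
  rewrite exchange_big /=; apply: eq_bigr => i _; rewrite mulr_sumr.
  by apply: eq_bigr => a _; rewrite mulrA.
apply: (abs_cvg_sum absA n
  (fun i N => c i * (\sum_(0 <= a < p ^ N) F i a%:R * (-1) ^+ a))
  (fun i => c i * l i)) => i ni.
by apply: (abs_cvgZ absA); case: (h i ni).
Qed.

End FermionicIntegral.

(** * Inverses of formal power series *)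

Section PowerSeriesInverse.
Context {K : fieldType}.
Variable f : fps K.

(** Solves the coefficient of t^n in f g = 1 for [g n]. *)
Let next (g : nat -> K) (n : nat) : K :=
  ((n == 0%N)%:R - \sum_(i < n) f (n - i)%N * g i) / f 0%N.

(** Each coefficient depends on all earlier ones, so the structural recursion returns the whole
    table of coefficients below [n], extended by 0. *)
Let Fixpoint inv_upto (n : nat) : nat -> K :=
  if n is m.+1 then fun k => if k == m then next (inv_upto m) m else inv_upto m k
  else fun=> 0.

Lemma fps_mulV : f 0%N != 0 -> fps_mul f (fps_inv f) = fps_const 1.
Proof.
move=> f0; apply: (@xgetPex _ (fun=> 0)
  [set g : nat -> K | fps_mul f g = fps_const 1])%classic.
pose g n := inv_upto n.+1 n.
have g_upto n k : (k < n)%N -> inv_upto n k = g k.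
  elim: n => // n IH; rewrite ltnS leq_eqVlt => /orP[/eqP->//|kn] /=.
  by rewrite ltn_eqF// IH.
have gE n : g n = next g n.
  rewrite /g /= eqxx /next; congr (_ / _); congr (_ - _).
  by apply: eq_bigr => i _; rewrite g_upto.
exists g => /=; apply/funext => n; rewrite /fps_mul (reindex_inj rev_ord_inj) /=.
under eq_bigr => i _ do rewrite subSS subKn -1?ltnS//.
rewrite big_ord_recr /= subnn gE /next mulrCA mulfV// mulr1.
by rewrite addrC subrK /fps_const; case: eqP.
Qed.

End PowerSeriesInverse.

(** * The moments of w^a and the coefficients of 2 / (w e^t + 1) *)

Section EulerNumbers.
Context {R : realType} {p : nat} {K : fieldType} {abs : K -> R}.
Hypotheses (p_prime : prime p) (p_odd : odd p).
Hypothesis absA : nonarch_absval abs.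
Hypothesis abs_p : abs p%:R = p%:R^-1.
Hypothesis abs_complete : forall u : nat -> K,
  abs_cauchy abs u -> exists l, abs_cvg abs u l.
Context {w : K}.
Hypothesis w_lt1 : abs (1 - w) < 1.

Let fact_neq0 n : n`!%:R != 0 :> K.
Proof. by rewrite (natr_neq0 p_prime absA abs_p) ?fact_gt0. Qed.

(** If w = -1, then 2 = 1 - w has absolute value below 1, whereas |2| = 1 for odd p. *)
Lemma addw1_neq0 : w + 1 != 0.
Proof.
apply/eqP => w1; have : abs 2 = 1.
  by apply: (abs_nat_coprime p_prime absA abs_p); rewrite coprimen2.
have -> : 2 = 1 - w + (w + 1) by ring.
by rewrite w1 addr0 => h; move: w_lt1; rewrite h ltxx.
Qed.

(** This is the coefficient of t^n in (w e^t + 1) g = 2. *)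
Lemma euler_series_rec n :
  w * (\sum_(i < n.+1) euler_series w (n - i)%N / i`!%:R) + euler_series w n =
  2 * (n == 0%N)%:R.
Proof.
rewrite /euler_series /fps_scale; set f := fps_add _ _; set g := fps_inv _.
have gE : fps_mul f g = fps_const 1.
  apply: fps_mulV; rewrite /f /fps_add /fps_scale /fps_exp /fps_const /=.
  by rewrite invr1 mulr1 addw1_neq0.
have {}gE : \sum_(i < n.+1) w / i`!%:R * g (n - i)%N + g n = (n == 0%N)%:R.
  transitivity (fps_const 1 n : K); last by rewrite /fps_const; case: eqP.
  rewrite -gE /fps_mul; under [RHS]eq_bigr => i _ do rewrite mulrDl.
  rewrite big_split /=; congr (_ + _).
  by rewrite big_ord_recl /= subn0 mul1r big1 ?addr0// => i _; rewrite mul0r.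
rewrite -gE mulrDr; congr (_ + _); rewrite !mulr_sumr.
by apply: eq_bigr => i _; ring.
Qed.

(** Dividing the moment sums by n! gives them the same recurrence as the coefficients of
    [euler_series], up to the right-hand side. *)
Let altsum N n := \sum_(0 <= a < p ^ N) w ^+ a * (a%:R ^+ n / n`!%:R) * (-1) ^+ a.

(* Telescoping sum: the shift a -> a + 1 flips the sign of (-1)^a. *)
Lemma alternating_sum_rec N n :
  w * (\sum_(i < n.+1) altsum N (n - i)%N / i`!%:R) + altsum N n =
  (n == 0%N)%:R + n`!%:R^-1 * (w ^+ (p ^ N) * (p ^ N)%:R ^+ n).
Proof.
pose G a : K := - (w ^+ a * (a%:R ^+ n / n`!%:R) * (-1) ^+ a).
(* The binomial theorem divided by n!, which turns binomial coefficients into inverse factorials. *)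
have taylor (a : nat) : a.+1%:R ^+ n / n`!%:R =
    \sum_(i < n.+1) a%:R ^+ (n - i) / (n - i)`!%:R / i`!%:R :> K.
  rewrite -natr1 exprDn mulr_suml; apply: eq_bigr => i _.
  have ni : (i <= n)%N by rewrite -ltnS.
  rewrite expr1n mulr1 -mulr_natr -(bin_fact ni) !natrM.
  have b0 : 'C(n, i)%:R != 0 :> K.
    by rewrite (natr_neq0 p_prime absA abs_p) ?bin_gt0.
  move: (fact_neq0 i) (fact_neq0 (n - i)) => i0 ni0.
  by field; rewrite b0 i0 ni0.
transitivity (\sum_(0 <= a < p ^ N) (G a.+1 - G a)).
  rewrite /altsum; under eq_bigr do rewrite mulr_suml.
  rewrite exchange_big mulr_sumr -big_split /=; apply: eq_bigr => a _.
  rewrite /G taylor; move: (_ ^+ n / _) => t.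
  rewrite opprK exprS exprS mulN1r mulrN opprK; congr (_ + _).
  rewrite !mulr_sumr mulr_suml; apply: eq_bigr => i _.
  by move: (_ / _) => v; ring.
rewrite telescope_sumr// /G opprK addrC; congr (_ + _).
  rewrite !expr0 mul1r mulr1; case: n {taylor G} => [|n] /=.
    by rewrite expr0 fact0 divr1.
  by rewrite expr0n mul0r.
(* As p^N is odd, the upper boundary term enters with a plus sign. *)
rewrite -signr_odd oddX p_odd orbT expr1 mulrN1 opprK; ring.
Qed.

(** Each end of the telescoped range contributes 1 when n = 0 and 0 in the limit otherwise: w^(p^N)
    tends to 1 and p^N to 0. *)
Let rhs_cvg n :
  abs_cvg abs (fun N => (n == 0%N)%:R + n`!%:R^-1 * (w ^+ (p ^ N) * (p ^ N)%:R ^+ n))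
    (2 * (n == 0%N)%:R).
Proof.
have -> : 2 * (n == 0%N)%:R = (n == 0%N)%:R + n`!%:R^-1 * (n == 0%N)%:R :> K.
  by case: n => [|n]; rewrite ?fact0 ?invr1 ?mulr0 ?addr0//=; ring.
apply: (abs_cvgD absA); first exact: abs_cvg_cst.
apply: (abs_cvgZ absA); apply/(abs_cvgP absA) => e e0.
case: n => [|n].
  have [k hk] := abs_expr_sub1_small p_prime absA abs_p w_lt1 e e0.
  exists k => N kN; rewrite expr0 mulr1; apply: hk.
  exact: dvdn_exp2l.
have p1 := @invp_itv R p p_prime.
have [k hk] := expr_lt_eventually _ _ p1 e0.
exists k => N /hk; apply: le_lt_trans.
rewrite subr0 (absM absA) (abs_wX absA w_lt1) mul1r exprS (absM absA).
rewrite (abs_pX absA abs_p) ler_piMr ?exprn_ge0//.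
by rewrite (absX absA) exprn_ile1 ?(abs_ge0 absA) ?abs_nat_le1.
Qed.

(** The term [i = 0] joins [u n] with total coefficient w + 1. Applied to the partial sums and to
    their claimed limits, the solved form lets convergence pass from lower indices to n. *)
Let solve_rec (u : nat -> K) n c :
  w * (\sum_(i < n.+1) u (n - i)%N / i`!%:R) + u n = c ->
  u n = (w + 1)^-1 * (c + (- w) * \sum_(i < n) (i.+1)`!%:R^-1 * u (n - i.+1)%N).
Proof.
move=> <-; apply: (mulfI addw1_neq0); rewrite mulVKf ?addw1_neq0//.
rewrite big_ord_recl /= subn0 fact0 divr1.
under eq_bigr => i _ do rewrite mulrC.
by rewrite /bump /=; ring.
Qed.

Lemma alternating_sum_cvg n : abs_cvg abs (fun N => altsum N n) (euler_series w n).
Proof.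
elim/ltn_ind: n => n IH.
rewrite (solve_rec _ _ _ (euler_series_rec n)).
under [X in abs_cvg _ X]eq_fun do rewrite (solve_rec _ _ _ (alternating_sum_rec _ n)).
apply: (abs_cvgZ absA); apply: (abs_cvgD absA); first exact: rhs_cvg.
apply: (abs_cvgZ absA); apply: (abs_cvg_sum absA n
  (fun i N => (i.+1)`!%:R^-1 * altsum N (n - i.+1)%N)
  (fun i => (i.+1)`!%:R^-1 * euler_series w (n - i.+1)%N)) => i ni.
by apply: (abs_cvgZ absA); apply: IH; lia.
Qed.

Lemma fermionic_int_moment n :
  is_fermionic_int p abs (fun a => padic_pow abs w a * a ^+ n)
    (n`!%:R * euler_series w n).
Proof.
split.
  have [l hl] := padic_pow_unif_deriv p_prime absA abs_p abs_complete w_lt1.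
  have pow_le1 := abs_padic_pow_le1 p_prime absA abs_p abs_complete w_lt1.
  have [|G' hG'] := has_unif_deriv_mulXn absA (padic_pow abs w)
    (fun x => l * padic_pow abs w x) (abs l) n pow_le1 _ hl.
    by move=> x xZ; rewrite (absM absA) ler_piMr ?(abs_ge0 absA) ?pow_le1.
  exact: (has_unif_deriv_differentiable absA _ _ hG').
have -> : (fun N => \sum_(0 <= a < p ^ N)
      padic_pow abs w a%:R * a%:R ^+ n * (-1) ^+ a) = (fun N => n`!%:R * altsum N n).
  apply/funext => N; rewrite /altsum mulr_sumr; apply: eq_bigr => a _.
  rewrite (padic_pow_nat p_prime absA abs_p w_lt1).
  by have := fact_neq0 n => ?; field.
exact/(abs_cvgZ absA)/alternating_sum_cvg.
Qed.

Lemma fermionic_int_expE : fermionic_int_exp p abs w = euler_series w.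
Proof.
apply/funext => n; rewrite /fermionic_int_exp.
by rewrite (fermionic_intE absA _ _ (fermionic_int_moment n)) mulrC mulKf.
Qed.

End EulerNumbers.

(** * Taylor's formula and the action of power series on polynomials *)

Section FactorialsNonzero.
Context {K : fieldType}.
Hypothesis fact_neq0 : forall n, n`!%:R != 0 :> K.

Lemma comp_polyXaddC_taylor (h : {poly K}) a :
  h \Po ('X + a%:P) = \sum_(k < size h) (a ^+ k / k`!%:R) *: h^`(k).
Proof.
(* Composition is evaluation over K[x] of [h] with constant coefficients, so Taylor's formula
   applies at the point 'X with increment [a%:P]. *)
rewrite /comp_poly nderiv_taylor; last exact: mulrC.
rewrite size_map_polyC; apply: eq_bigr => k _.
rewrite nderivn_map -/(comp_poly _ _) comp_polyXr.
rewrite nderivn_def -scaler_nat scalerA divfK ?fact_neq0// mulrC.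
by rewrite -polyC_exp mul_polyC.
Qed.

(** The k-th derivative of x^n is n! x^(n-k) / (n-k)!, which is n! times the coefficient of t^(n-k)
    in e^{xt}. *)
Lemma weighted_eulerE (w : K) n : weighted_euler w n = fps_act (euler_series w) 'X^n.
Proof.
rewrite /weighted_euler /fps_mul /fps_act size_polyXn scaler_sumr.
apply: eq_bigr => k _; have kn : (k <= n)%N by rewrite -ltnS.
rewrite derivnXn /fps_expX mul_polyC !scalerA -scaler_nat scalerA; congr (_ *: _).
rewrite -(ffact_fact kn) natrM.
by have := fact_neq0 (n - k) => ?; field.
Qed.

End FactorialsNonzero.

(** * From moments to arbitrary polynomials *)

Theorem theorem2p5 (R : realType) (p : nat) (p_prime : prime p) (p_odd : odd p)
    (K : fieldType) (abs : K -> R) (KCp : is_Cp p abs)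
    (w : K) (w_lt1 : abs (1 - w) < 1) :
  [/\ (* the coefficients of the integral of w^a e^{at} are well defined *)
      forall n : nat,
        fermionic_integrable p abs (fun a => padic_pow abs w a * a ^+ n),
      forall h : {poly K},
        is_fermionic_int_poly p abs
          (fun a => padic_pow abs w a *: (h \Po ('X + a%:P)))
          (fps_act (fermionic_int_exp p abs w) h) /\
        fps_act (fermionic_int_exp p abs w) h = fps_act (euler_series w) h
    & forall n : nat,
        weighted_euler w n = fps_act (fermionic_int_exp p abs w) 'X^n /\
        fps_act (fermionic_int_exp p abs w) 'X^n = fps_act (euler_series w) 'X^n].
Proof.
have [absA abs_p abs_complete _ _] := KCp.
have fact_neq0 k : k`!%:R != 0 :> K.
  by rewrite (natr_neq0 p_prime absA abs_p) ?fact_gt0.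
have moment := fermionic_int_moment p_prime p_odd absA abs_p abs_complete w_lt1.
rewrite (fermionic_int_expE p_prime p_odd absA abs_p abs_complete w_lt1).
split=> [n|h|n]; first by eexists; exact: moment.
- split=> // i.
  (* By Taylor's formula, [c k] is the weight of the k-th moment integrand in the coefficient of x^i
     of w^a h(x + a). *)
  pose c k := (h^`(k))`_i / k`!%:R.
  have -> : (fps_act (euler_series w) h)`_i =
      \sum_(k < size h) c k * (k`!%:R * euler_series w k).
    rewrite coef_sum; apply: eq_bigr => k _; rewrite coefZ /c.
    by have := fact_neq0 k => ?; field.
  have -> : (fun a => (padic_pow abs w a *: (h \Po ('X + a%:P)))`_i) =
      (fun a => \sum_(k < size h) c k * (padic_pow abs w a * a ^+ k)).
    apply/funext => a; rewrite (comp_polyXaddC_taylor fact_neq0).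
    rewrite coefZ coef_sum mulr_sumr; apply: eq_bigr => k _.
    by rewrite coefZ /c; ring.
  exact: (is_fermionic_int_lincomb absA (size h) c
    (fun k => k`!%:R * euler_series w k)
    (fun k a => padic_pow abs w a * a ^+ k) (fun k _ => moment k)).
- by rewrite (weighted_eulerE fact_neq0).
Qed.
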